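(* Let $n\ge 1$ and $h\ge 0$ be integers and let $L=\{0,1,\dots,n-1\}$. Define forests (sets of labeled rooted trees, up to label-preserving isomorphism of rooted trees) recursively by $G_0=\{\mathrm{root}\}$ and, for $i\ge 1$, $$G_i=\{\mathrm{root},\ \mathcal{R}(T_0,G_{i-1})\}\wedge\{\mathrm{root},\ \mathcal{R}(T_1,G_{i-1})\}\wedge\cdots\wedge\{\mathrm{root},\ \mathcal{R}(T_{n-1},G_{i-1})\}.$$ Then the forest $G_h$ contains every rooted tree of height at most $h$ whose vertices carry a valid label assignment with labels from $L$.
   Context: A rooted tree is a tree with a distinguished vertex, the root. The height of a rooted tree is the maximum distance (number of edges) from the root to a vertex. A label assignment on a rooted tree is valid if the root is unlabeled (denoted $r$), every non-root vertex receives a label, and no two sibling vertices (children of the same parent) receive the same label. Trees are considered up to isomorphism of rooted trees preserving labels (children are unordered). $\mathrm{root}$ denotes the tree consisting of the root vertex alone. $T_k$ denotes the tree consisting of the root and a single child labeled $k$. Grafting of trees: $T_\alpha\wedge T_\beta$ is the rooted tree obtained by identifying the roots of $T_\alpha$ and $T_\beta$ (so the children subtrees of the new root are those of $T_\alpha$ together with those of $T_\beta$); $\mathrm{root}$ is the identity for grafting. Grafting of forests: for forests $\mathcal{F},\mathcal{G}$, $\mathcal{F}\wedge\mathcal{G}=\{T\wedge T' : T\in\mathcal{F},\,T'\in\mathcal{G}\}$. Raising: for a tree $T_\alpha$ and forest $\mathcal{F}$, $\mathcal{R}(T_\alpha,\mathcal{F})$ is the forest obtained by replacing each tree $T\in\mathcal{F}$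 with the tree obtained from $T_\alpha$ by attaching a copy of $T$ at every leaf of $T_\alpha$ (identifying the root of the copy of $T$ with that leaf); by convention $\mathcal{R}(T_\alpha,\mathrm{root})=T_\alpha$. In the recursion, $\{\mathrm{root},\mathcal{R}(T_k,G_{i-1})\}$ denotes the forest consisting of $\mathrm{root}$ together with all trees of $\mathcal{R}(T_k,G_{i-1})$. *)

(* Defs.v *)
From mathcomp Require Import all_boot.

Set Implicit Arguments.
Unset Strict Implicit.
Unset Printing Implicit Defensive.

(* Finite rooted graphs; [None] means "unlabeled". The rooted trees are those
   satisfying [is_tree] below. *)
Record lgraph (A : Type) := LGraph {
  vertex : finType;
  adj : rel vertex;
  troot : vertex;
  label : vertex -> option A }.
Arguments adj {A} l.
Arguments troot {A} l.
Arguments label {A} l.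

Section Trees.
Variable A : Type.
Implicit Types T : lgraph A.

(* [ucycle (adj T) c] says that c is a closed walk without repeated vertices;
   for size 2 this would be an edge traversed back and forth. *)
Definition is_tree T : Prop :=
  [/\ symmetric (adj T),
      irreflexive (adj T),
      forall x y : vertex T, connect (adj T) x y
    & forall c : seq (vertex T), 2 < size c -> ~ ucycle (adj T) c].

(* Least number of edges of a walk from x to y, and #|vertex T| if there is
   none. *)
Definition dist T (x y : vertex T) : nat :=
  find (fun k => [exists p : k.-tuple (vertex T),
                    path (adj T) x p && (last x p == y)])
       (iota 0 #|vertex T|).

Definition height T : nat := \max_(v : vertex T) dist (troot T) v.

Definition is_child T (p v : vertex T) : bool :=
  adj T p v && (dist (troot T) v == (dist (troot T) p).+1).

(* The root of a one-vertex tree is a leaf; a root of degree one is not. *)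
Definition leaf T (v : vertex T) : bool := [forall u, ~~ is_child v u].

Definition valid_labeling T : Prop :=
  [/\ label T (troot T) = None,
      forall v, v != troot T -> label T v <> None
    & forall p u v : vertex T, is_child p u -> is_child p v -> u != v ->
        label T u <> label T v].

Definition iso T T' : Prop :=
  exists f : vertex T -> vertex T',
    [/\ bijective f,
        f (troot T) = troot T',
        forall x y, adj T' (f x) (f y) = adj T x y
      & forall x, label T' (f x) = label T x].

Definition root_tree : lgraph A :=
  @LGraph A unit (fun _ _ => false) tt (fun _ => None).

Definition single_child (k : A) : lgraph A :=
  @LGraph A bool (fun x y => x != y) false
    (fun x => if x then Some k else None).

(* Wedge of pointed graphs inside the product of the vertex sets: (x, root) is
   the vertex x of T1, (root, y) is the vertex y of T2. *)
Definition graft_vertex T1 T2 : finType :=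
  {p : vertex T1 * vertex T2 | (p.1 == troot T1) || (p.2 == troot T2)}.

Definition graft T1 T2 : lgraph A :=
  @LGraph A (graft_vertex T1 T2)
    (fun p q =>
       [&& (val p).2 == troot T2, (val q).2 == troot T2
         & adj T1 (val p).1 (val q).1]
    || [&& (val p).1 == troot T1, (val q).1 == troot T1
         & adj T2 (val p).2 (val q).2])
    (exist _ (troot T1, troot T2) (introT orP (or_introl (eqxx _))))
    (fun p => if (val p).2 == troot T2 then label T1 (val p).1
              else label T2 (val p).2).

(* (x, root) is the vertex x of T1; for x a leaf of T1, (x, y) is the vertex y
   in the copy of T2 attached at x. Hence x and the root of the copy of T2
   attached at x are the same vertex, which keeps the label of x. *)
Definition raise_vertex T1 T2 : finType :=
  {p : vertex T1 * vertex T2 | leaf p.1 || (p.2 == troot T2)}.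

Definition raise T1 T2 : lgraph A :=
  @LGraph A (raise_vertex T1 T2)
    (fun p q =>
       [&& (val p).2 == troot T2, (val q).2 == troot T2
         & adj T1 (val p).1 (val q).1]
    || [&& (val p).1 == (val q).1, leaf (val p).1
         & adj T2 (val p).2 (val q).2])
    (exist _ (troot T1, troot T2) (introT orP (or_intror (eqxx _))))
    (fun p => if (val p).2 == troot T2 then label T1 (val p).1
              else label T2 (val p).2).

(* Forests are sets of representatives; membership up to isomorphism is
   [contains]. *)
Definition forest := lgraph A -> Prop.

Definition contains (F : forest) T : Prop := exists2 T', F T' & iso T' T.

Definition root_forest : forest := fun T => T = root_tree.

Definition union_forest (F F' : forest) : forest := fun T => F T \/ F' T.

Definition graft_forest (F F' : forest) : forest :=
  fun S => exists T T', [/\ F T, F' T' & S = graft T T'].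

Definition raise_forest T (F : forest) : forest :=
  fun S => exists2 T', F T' & S = raise T T'.

End Trees.

Arguments root_forest {A}.

(* The iterated grafting ends with [root_forest], the identity for grafting up
   to isomorphism. *)
Fixpoint G (n i : nat) : forest 'I_n :=
  if i is j.+1 then
    \big[@graft_forest 'I_n/root_forest]_(k < n)
      union_forest root_forest (raise_forest (single_child k) (@G n j))
  else root_forest.

Arguments G n i _ : clear implicits.

(* Main.v *)
(** In a tree, deleting an edge disconnects its endpoints; hence every edge
    joins consecutive levels and every vertex other than the root has exactly
    one neighbour [parent v] in the previous level. The vertices of the branch
    at [r] are those whose iterated parent is [r]. By induction on the height,
    each branch is the image of an embedding of some tree of [G n h]: valid
    labels give at most one child for each [k], so that the [k]-th factor of
    the iterated grafting can be chosen to be [root] if there is none and the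
    raised tree of the branch at that child otherwise. Working with embeddings
    into the one ambient tree avoids forming subtrees. *)

Require Import Defs.
From mathcomp Require Import all_boot.
From mathcomp Require Import zify.

Set Implicit Arguments.
Unset Strict Implicit.
Unset Printing Implicit Defensive.

(** * Shortest walks *)

Section Distance.
Variables (A : Type) (T : lgraph A).
Implicit Types x y z : vertex T.

Lemma dist_le_walk x p : path (adj T) x p -> dist x (last x p) <= size p.
Proof.
(* Walks with at least [#|vertex T|] edges satisfy the bound because [find] never exceeds the length
   of its list. *)
move=> xp; case: (ltnP (size p) #|vertex T|) => hp; last first.
  by apply: leq_trans hp; rewrite -[leqRHS](size_iota 0) find_size.
rewrite leqNgt; apply/negP => /(before_find 0).
rewrite nth_iota // add0n => /existsP[]; exists (in_tuple p).
by rewrite xp eqxx.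
Qed.

Lemma distxx x : dist x x = 0.
Proof. by apply/eqP; rewrite -leqn0; apply: (@dist_le_walk x [::]). Qed.

(** Shortening a walk removes repeated vertices, so its length falls below [#|vertex T|] and the
    search in [dist] succeeds. *)
Lemma dist_walk x y : connect (adj T) x y ->
  exists p, [/\ path (adj T) x p, last x p = y & size p = dist x y].
Proof.
case/connectP => p0 /shortenP[p xp up _] ->.
have hp : size p < #|vertex T|.
  by apply: leq_trans (max_card (mem (x :: p))); rewrite (card_uniqP up).
have : has (fun k => [exists q : k.-tuple (vertex T),
    path (adj T) x q && (last x q == last x p)]) (iota 0 #|vertex T|).
  apply/hasP; exists (size p); first by rewrite mem_iota.
  by apply/existsP; exists (in_tuple p); rewrite xp eqxx.
move=> hs; have := nth_find 0 hs; move: (hs); rewrite has_find size_iota => lt.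
rewrite nth_iota // add0n => /existsP[q /andP[xq /eqP eq]].
by exists q; rewrite size_tuple.
Qed.

Lemma dist_eq0 x y : connect (adj T) x y -> dist x y = 0 -> y = x.
Proof. by case/dist_walk => -[|z p] [_ <- <-]. Qed.

Lemma dist_adj x y z : connect (adj T) x y -> adj T y z ->
  dist x z <= (dist x y).+1.
Proof.
case/dist_walk => p [xp <- <-] yz.
by rewrite -(size_rcons p z) -{1}(last_rcons x p z) dist_le_walk // rcons_path xp.
Qed.

End Distance.

(** * Levels and parents in a tree *)

Section Parent.
Variables (A : Type) (T : lgraph A).
Hypothesis T_tree : is_tree T.
Implicit Types u v w x y : vertex T.

Local Notation depth := (dist (troot T)).

Let adjC : symmetric (adj T). Proof. by case: T_tree. Qed.
Let adjxx : irreflexive (adj T). Proof. by case: T_tree. Qed.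
Let conn x y : connect (adj T) x y. Proof. by case: T_tree. Qed.

Lemma depth_adj x y : adj T x y -> depth y <= (depth x).+1.
Proof. exact: dist_adj. Qed.

(** The parent is the last vertex but one of a shortest walk from the root. *)
Lemma exists_parent v : v != troot T ->
  exists2 p, adj T p v & depth v = (depth p).+1.
Proof.
move=> v0; have [p [rp lp sp]] := dist_walk (conn (troot T) v).
case/lastP: p => [|p z] in rp lp sp *; first by rewrite -lp eqxx in v0.
rewrite last_rcons in lp; subst z.
move: rp; rewrite rcons_path => /andP[rp lv]; exists (last (troot T) p) => //.
have := dist_le_walk rp; have := depth_adj lv.
by move: sp; rewrite size_rcons; lia.
Qed.

Definition delete_edge x y : rel (vertex T) := fun a b =>
  adj T a b && ((a, b) \notin [:: (x, y); (y, x)]).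

Lemma delete_edge_sym x y : symmetric (delete_edge x y).
Proof.
move=> a b; rewrite /delete_edge adjC !inE !xpair_eqE orbC.
by rewrite [(b == x) && _]andbC [(b == y) && _]andbC.
Qed.

(** A repetition-free path avoiding the edge would form a cycle together with it. *)
Lemma delete_edge_disconnects x y : adj T x y ->
  ~~ connect (delete_edge x y) x y.
Proof.
move=> xy; apply/negP => /connectP[p0 /shortenP[p xp up _] lp].
have [_ _ _ acyclic] := T_tree; apply: (acyclic (x :: p)).
  (* At least three vertices: an empty path would make the edge a loop, and a path of one edge would
     be the deleted edge. *)
  case: p xp lp {up} => [_ yx|z [|//]] /=.
    by move: xy; rewrite /= yx adjxx.
  by rewrite /delete_edge andbT => /andP[_ zN] yz; rewrite yz !inE eqxx in zN.
rewrite /ucycle up andbT /= rcons_path -lp adjC xy andbT.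
by apply: sub_path xp => a b /andP[].
Qed.

(** Climbing from parent to parent uses only edges between consecutive levels. This shows which
    vertices stay reachable once an edge is deleted. *)
Lemma connect_below (e : rel (vertex T)) N :
    (forall a b, adj T a b -> depth b = (depth a).+1 -> depth b <= N -> e a b) ->
  forall u, depth u <= N -> connect e (troot T) u.
Proof.
move=> eP u; move Ed : (depth u) => d; elim: d u Ed => [|d IH] u Ed dN.
  by rewrite (dist_eq0 (conn _ _) Ed).
have [|p pu dp] := exists_parent (v := u).
  by apply/eqP => u0; rewrite u0 distxx in Ed.
apply: connect_trans (IH p _ _) (connect1 (eP _ _ pu dp _)); lia.
Qed.

(** An edge within one level lies on no descent from the root, so deleting it would leave both ends
    connected to the root. *)
Lemma depth_adj_neq x y : adj T x y -> depth x <> depth y.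
Proof.
move=> xy dxy; have /negP[] := delete_edge_disconnects xy.
have low u : depth u <= depth x -> connect (delete_edge x y) (troot T) u.
  apply: connect_below => a b ab dab _; rewrite /delete_edge ab.
  by apply/negP; rewrite !inE !xpair_eqE => /orP[]/andP[/eqP ? /eqP ?];
    subst; lia.
rewrite (connect_trans _ (low y _)) -?dxy //.
by rewrite (sym_connect_sym (delete_edge_sym x y)) low.
Qed.

(** With two parents, deleting the edge from [p] to [v] would leave the detour from [p] up to the
    root, down to [q] and on to [v]. *)
Lemma parent_uniq v p q : adj T p v -> adj T q v ->
  depth v = (depth p).+1 -> depth v = (depth q).+1 -> p = q.
Proof.
move=> pv qv dp dq; apply/eqP/negPn/negP => npq.
have /negP[] := delete_edge_disconnects pv.
have low u : depth u <= depth p -> connect (delete_edge p v) (troot T) u.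
  apply: connect_below => a b ab dab bp; rewrite /delete_edge ab.
  by apply/negP; rewrite !inE !xpair_eqE => /orP[]/andP[/eqP ? /eqP ?];
    subst; lia.
have csym := sym_connect_sym (delete_edge_sym p v).
apply: (@connect_trans _ _ (troot T)); first by rewrite csym low.
apply: (@connect_trans _ _ q); first by apply: low; lia.
apply: connect1; rewrite /delete_edge qv !inE !xpair_eqE eqxx andbT.
rewrite eq_sym (negPf npq) /=; apply/negP => /andP[/eqP ? /eqP ?].
by subst; lia.
Qed.

(** The default is taken at the root only, which becomes a fixed point. *)
Definition parent v : vertex T := odflt (troot T) [pick p | is_child p v].

Lemma parentP v : v != troot T -> is_child (parent v) v.
Proof.
move=> v0; rewrite /parent; case: pickP => [//|no].
have [p pv dp] := exists_parent v0.
by have := no p; rewrite /is_child pv dp eqxx.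
Qed.

Lemma is_childE p v : is_child p v = (v != troot T) && (parent v == p).
Proof.
apply/idP/andP => [|[v0 /eqP <-]]; last exact: parentP.
move=> pv; have /andP[apv /eqP dpv] := pv.
have v0 : v != troot T by apply/eqP => v0; move: dpv; rewrite v0 distxx.
split=> //; have /andP[aqv /eqP dqv] := parentP v0.
by apply/eqP; apply: (parent_uniq aqv apv).
Qed.

Lemma adj_is_child x y : adj T x y = is_child x y || is_child y x.
Proof.
rewrite /is_child [adj T y x]adjC -andb_orr; case xy: (adj T x y) => //=.
have := depth_adj_neq xy; have := depth_adj xy.
have := @depth_adj y x; rewrite adjC xy => /(_ isT); lia.
Qed.

Lemma parent_root : parent (troot T) = troot T.
Proof.
by rewrite /parent; case: pickP => // p; rewrite is_childE eqxx.
Qed.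

Lemma depth_parent v : depth (parent v) = (depth v).-1.
Proof.
have [->|/parentP/andP[_ /eqP->]//] := eqVneq v (troot T).
by rewrite parent_root distxx.
Qed.

Lemma depth_iter_parent i v : depth (iter i parent v) = depth v - i.
Proof. by elim: i => [|i IH] /=; rewrite ?subn0 // depth_parent IH; lia. Qed.

(** * Branches *)

Definition branch v : {pred vertex T} := fun u =>
  (depth v <= depth u) && (iter (depth u - depth v) parent u == v).

Lemma branchxx v : branch v v.
Proof. by rewrite /branch leqnn subnn eqxx. Qed.

Lemma branch_root v : branch (troot T) v.
Proof.
rewrite /branch distxx /= subn0; apply/eqP/(dist_eq0 (conn _ _)).
by rewrite depth_iter_parent subnn.
Qed.

Lemma branch_depth r u : branch r u -> depth u <= depth r -> u = r.
Proof.
move=> /andP[ru /eqP ur] ur'; have E : depth u - depth r = 0 by lia.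
by rewrite E in ur.
Qed.

Lemma branch_eq v w u : branch v u -> branch w u -> depth v = depth w -> v = w.
Proof.
by move=> /andP[_ /eqP uv] /andP[_ /eqP uw] E; rewrite E uw in uv.
Qed.

Lemma branch_child r v u : is_child r v -> branch v u -> branch r u.
Proof.
rewrite is_childE => /andP[v0 /eqP vr] /andP[du /eqP uv].
have /andP[_ /eqP dv] := parentP v0; rewrite vr in dv.
rewrite /branch; have -> : depth u - depth r = (depth u - depth v).+1 by lia.
by rewrite iterS uv vr eqxx andbT; lia.
Qed.

Lemma branch_is_child r u w : branch r u -> is_child u w -> branch r w.
Proof.
move=> /andP[du /eqP ur]; rewrite is_childE => /andP[w0 /eqP wu].
have /andP[_ /eqP dw] := parentP w0; rewrite wu in dw.
rewrite /branch; have -> : depth w - depth r = (depth u - depth r).+1 by lia.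
by rewrite iterSr wu ur eqxx andbT; lia.
Qed.

Lemma branch_split r u : branch r u -> u != r ->
  exists2 v, is_child r v & branch v u.
Proof.
move=> ru ur; have dru : depth r < depth u.
  by rewrite ltnNge; apply: contra ur => /(branch_depth ru)->.
have /andP[_ /eqP itr] := ru.
(* The ancestor of [u] one iteration short of [r]. *)
pose v := iter (depth u - depth r).-1 parent u.
have dv : depth v = (depth r).+1 by rewrite depth_iter_parent; lia.
exists v.
  rewrite is_childE; apply/andP; split.
    by apply/eqP => v0; rewrite v0 distxx in dv.
  by rewrite -iterS prednK ?itr //; lia.
rewrite /branch dv dru; apply/eqP; congr (iter _ _ _); lia.
Qed.

Lemma is_child_depth r v : is_child r v -> depth v = (depth r).+1.
Proof. by case/andP => _ /eqP. Qed.

(** A neighbour of [r] in the branch must lie on the level of [v], where the branch contains only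
    [v]. *)
Lemma adj_branch r v u : is_child r v -> branch v u -> adj T r u = (u == v).
Proof.
move=> rv vu; have dv := is_child_depth rv; have /andP[du _] := vu.
rewrite adj_is_child; apply/idP/eqP => [|->]; last by rewrite rv.
by case/orP => /is_child_depth d; first apply: (branch_depth vu); lia.
Qed.

(** Branches are closed under children, so the lower end of such an edge would lie in both, having
    two ancestors on one level. *)
Lemma adj_distinct_branches r v w x y : is_child r v -> is_child r w ->
  v != w -> branch v x -> branch w y -> ~~ adj T x y && (x != y).
Proof.
move=> rv rw vw vx wy.
have dvw : depth v = depth w by rewrite (is_child_depth rv) (is_child_depth rw).
have neq u : branch v u -> branch w u -> False.
  by move=> vu wu; rewrite (branch_eq vu wu dvw) eqxx in vw.
apply/andP; split; last by apply/eqP => xy; subst; apply: (neq y).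
rewrite adj_is_child; apply/negP => /orP[] c.
  by apply: (neq y) => //; apply: branch_is_child vx c.
by apply: (neq x) => //; apply: branch_is_child wy c.
Qed.

End Parent.

(** * Embeddings of grafted and raised trees *)

Section Embedding.
Variables (A : Type) (T : lgraph A).
Implicit Types (S : lgraph A) (D : {pred vertex T}) (r v : vertex T).

(* The root of S is unlabeled even when its image r carries a label. *)
Definition embeds S D r : Prop :=
  exists f : vertex S -> vertex T,
    [/\ injective f, f (troot S) = r, forall y, (y \in codom f) = D y,
        forall x y, adj T (f x) (f y) = adj S x y
      & forall x, label S x = if x == troot S then None else label T (f x)].

Lemma eq_embeds S D D' r : D =1 D' -> embeds S D r -> embeds S D' r.
Proof.
by move=> DD' [f [? ? fD ? ?]]; exists f; split=> // y; rewrite fD DD'.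
Qed.

Lemma embeds_iso S : label T (troot T) = None ->
  embeds S predT (troot T) -> iso S T.
Proof.
move=> lr [f [fI f0 fD fA fL]]; exists f; split=> //.
  apply: inj_card_bij => //; rewrite -(card_codom fI).
  by apply: subset_leq_card; apply/subsetP => y _; rewrite fD.
by move=> x; rewrite fL; case: eqP => // ->; rewrite f0.
Qed.

Lemma embeds_root_tree r : ~~ adj T r r -> embeds (root_tree A) (pred1 r) r.
Proof.
move=> rr; exists (fun=> r); split=> //.
- by case=> -[].
- move=> y; apply/codomP/eqP => [[_ ->]//|->]; by exists tt.
- by move=> x y; apply: negbTE.
Qed.

(** The two images meet only in [r] and no edge joins them elsewhere, so the embeddings glue along
    the common root. *)
Lemma embeds_graft S1 S2 D1 D2 r : symmetric (adj T) ->
    (forall x y, D1 x -> D2 y -> x != r -> y != r -> ~~ adj T x y && (x != y)) ->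
  embeds S1 D1 r -> embeds S2 D2 r -> embeds (graft S1 S2) (predU D1 D2) r.
Proof.
move=> adjC D12 [f [fI f0 fD fA fL]] [g [gI g0 gD gA gL]].
have fD' x : D1 (f x) by rewrite -fD codom_f.
have gD' x : D2 (g x) by rewrite -gD codom_f.
have fg x y : x != troot S1 -> y != troot S2 ->
    ~~ adj T (f x) (g y) && (f x != g y).
  move=> x0 y0; apply: D12 => //.
    by rewrite -f0 (inj_eq fI).
  by rewrite -g0 (inj_eq gI).
(* Adjacency in a graft at the pair of roots combines both root loops; they agree because both map
   to [r]. *)
have a0 : adj S1 (troot S1) (troot S1) = adj S2 (troot S2) (troot S2).
  by rewrite -fA -gA f0 g0.
have fr x : adj T (f x) r = adj S1 x (troot S1) by rewrite -f0 fA.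
have gr x : adj T (g x) r = adj S2 x (troot S2) by rewrite -g0 gA.
have rf x : adj T r (f x) = adj S1 (troot S1) x by rewrite -f0 fA.
have rg x : adj T r (g x) = adj S2 (troot S2) x by rewrite -g0 gA.
exists (fun p : vertex (graft S1 S2) =>
  if (val p).2 == troot S2 then f (val p).1 else g (val p).2).
split.
- move=> [[x y] /= xy] [[x' y'] /= xy'] /= H; apply: val_inj => /=.
  move: xy xy' H.
  (* Four cases, by the factor containing each vertex; mixed cases reduce to the common root or to
     [fg]. *)
  have [->|y0] := eqVneq y (troot S2); have [->|y0'] := eqVneq y' (troot S2);
    rewrite ?orbT ?orbF.
  + by move=> _ _ /fI ->.
  + move=> _ /eqP ->; have [->|x0] := eqVneq x (troot S1).
      by rewrite f0 -g0 => /gI ->.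
    by move=> H; have := fg _ _ x0 y0'; rewrite H eqxx andbF.
  + move=> /eqP -> _; have [->|x0] := eqVneq x' (troot S1).
      by rewrite f0 -g0 => /gI ->.
    by move=> H; have := fg _ _ x0 y0; rewrite H eqxx andbF.
  + by move=> /eqP -> /eqP -> /gI ->.
- by rewrite /= eqxx.
- move=> y; rewrite /= -fD -gD; apply/codomP/orP => [[[[a b] ab] /= ->]|].
    by case: ifP => _; [left|right]; apply: codom_f.
  case=> /codomP[x ->].
    have h : (x == troot S1) || (troot S2 == troot S2) by rewrite eqxx orbT.
    by exists (exist _ (x, troot S2) h); rewrite /= eqxx.
  have h : (troot S1 == troot S1) || (x == troot S2) by rewrite eqxx.
  by exists (exist _ (troot S1, x) h) => /=; case: eqP => // ->; rewrite f0 g0.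
- move=> [[x y] /= xy] [[x' y'] /= xy'] /=; move: xy xy'.
  have [->|y0] := eqVneq y (troot S2); have [->|y0'] := eqVneq y' (troot S2);
    rewrite ?orbT ?orbF /=.
  + rewrite fA -a0; have [->|] := eqVneq x (troot S1) => //=; last first.
      by rewrite orbF.
    have [->|] := eqVneq x' (troot S1) => //=; first by rewrite orbb.
    by rewrite orbF.
  + move=> _ /eqP ->; rewrite eqxx /=; have [->|x0] := eqVneq x (troot S1).
      by rewrite f0 rg.
    by have /andP[/negbTE] := fg _ _ x0 y0'.
  + move=> /eqP -> _; rewrite eqxx /=; have [->|x0] := eqVneq x' (troot S1).
      by rewrite f0 gr.
    by have /andP[/negbTE] := fg _ _ x0 y0; rewrite adjC.
  + by move=> /eqP -> /eqP ->; rewrite gA eqxx.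
- move=> [[x y] /= xy] /=; rewrite -val_eqE /= xpair_eqE; move: xy.
  have [_|y0] := eqVneq y (troot S2); rewrite ?andbT ?andbF => _.
    by rewrite fL.
  by rewrite gL (negbTE y0).
Qed.

(** Only the child, encoded as [true], is a leaf, so raising attaches a single copy. *)
Lemma leaf_single_child (k : A) (b : bool) : @leaf A (single_child k) b = b.
Proof.
pose t := single_child k.
have d0 : @dist _ t false false = 0 by apply: distxx.
have d1 : @dist _ t false true = 1.
  have := @dist_le_walk _ t false [:: true] isT.
  have : connect (adj t) false true by apply: connect1.
  move=> /dist_eq0; rewrite [last _ _]/=; case: (dist _ _) => [/(_ erefl)//|[|]//].
apply/forallP; case: b => [u|/(_ true)]; rewrite /is_child.
  by rewrite [troot _]/= d1; case: u; rewrite ?d0 ?d1 andbF.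
by rewrite [troot _]/= d0 d1.
Qed.

(** The root of [S] goes to [v]; raising gives it the label [k] that [embeds] disregards there. *)
Lemma embeds_raise S D r v k : symmetric (adj T) -> ~~ adj T r r -> ~~ D r ->
    (forall x, D x -> adj T r x = (x == v)) -> label T v = Some k ->
  embeds S D v -> embeds (raise (single_child k) S) (predU1 r D) r.
Proof.
move=> adjC rr Dr rD vk [f [fI f0 fD fA fL]].
have fD' x : D (f x) by rewrite -fD codom_f.
have rf x : adj T r (f x) = (x == troot S).
  by rewrite rD // -f0 (inj_eq fI).
have fr x : f x == r = false.
  by apply/eqP => E; rewrite -E fD' in Dr.
exists (fun p : vertex (raise (single_child k) S) =>
  if (val p).1 then f (val p).2 else r).
split.
- move=> [[x y] /= xy] [[x' y'] /= xy'] /= H; apply: val_inj => /=.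
  move: xy xy' H; rewrite !leaf_single_child.
  case: x x' => [] [] /= => [_ _ /fI->//|_ _ /eqP|_ _ /esym/eqP|/eqP-> /eqP->//];
    by rewrite fr.
- by [].
- move=> y; rewrite /= -fD; apply/codomP/predU1P => [[[[a b] ab] /= ->]|].
    by case: ifP => _; [right; apply: codom_f|left].
  case=> [->|/codomP[x ->]].
    by exists (troot (raise (single_child k) S)).
  have h : @leaf _ (single_child k) true || (x == troot S).
    by rewrite leaf_single_child.
  by exists (exist _ (true, x) h).
- move=> [[x y] /= xy] [[x' y'] /= xy'] /=; move: xy xy'.
  rewrite !leaf_single_child.
  case: x x' => [] [] /=; rewrite ?andbF ?andbT ?orbF //=.
  + by move=> _ /eqP->; rewrite eqxx andbT adjC rf.
  + by move=> /eqP-> _; rewrite eqxx rf.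
  + by move=> _ _; apply: negbTE.
- move=> [[x y] /= xy] /=; rewrite -val_eqE /= xpair_eqE; move: xy.
  rewrite leaf_single_child; case: x => /= [_|/eqP->]; last by rewrite eqxx.
  rewrite fL; case: eqP => // ->; by rewrite f0 vk.
Qed.

End Embedding.

(** * Branches as members of the recursive forests *)

Section Decomposition.
Variables (n : nat) (T : lgraph 'I_n).
Hypotheses (T_tree : is_tree T) (T_valid : valid_labeling T).

Local Notation depth := (dist (troot T)).

Let adjC : symmetric (adj T). Proof. by case: T_tree. Qed.
Let adjxx x : ~~ adj T x x. Proof. by case: T_tree => _ ->. Qed.

(** A partial list of labels allows induction along the iterated grafting. *)
Definition branches (r : vertex T) (s : seq 'I_n) : {pred vertex T} := fun u =>
  (u == r) ||
  [exists v, [&& is_child r v, label T v \in map some s & branch v u]].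

Lemma embeds_branches (F : 'I_n -> forest 'I_n) r s : uniq s ->
    (forall v k, is_child r v -> label T v = Some k ->
       exists2 S, F k S & embeds S (branch v) v) ->
  exists2 S, (\big[@graft_forest 'I_n/root_forest]_(k <- s)
                union_forest root_forest (raise_forest (single_child k) (F k))) S
           & embeds S (branches r s) r.
Proof.
move=> us FP; elim: s us => [_|k s IH /andP[ks us]].
  exists (root_tree 'I_n); first by rewrite big_nil.
  apply: eq_embeds (embeds_root_tree (adjxx r)) => u; rewrite /branches /=.
  by case: eqP => //= _; symmetry; apply/negbTE/existsPn => v; rewrite andbF.
have [S2 FS2 eS2] := IH us.
(* A child labeled [k] selects the raised tree as factor; otherwise the factor is [root_tree]. *)
case: (pickP (fun v => is_child r v && (label T v == Some k))).
  move=> v /andP[rv /eqP vk]; have [S FS eS] := FP _ _ rv vk.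
  have Dr : ~~ branch v r by rewrite /branch (is_child_depth rv) ltnn.
  have := embeds_raise adjC (adjxx r) Dr
    (fun u => @adj_branch _ _ T_tree r v u rv) vk eS.
  move=> eS1; exists (graft (raise (single_child k) S) S2).
    rewrite big_cons; exists (raise (single_child k) S), S2; split=> //.
    by right; exists S.
  apply: eq_embeds (embeds_graft adjC _ eS1 eS2).
    move=> u; rewrite /branches /= -orbA; case: eqP => //= _.
    apply/orP/existsP => [[vu|/existsP[w /and3P[rw ws wu]]]|[w]].
    - by exists v; rewrite rv vk inE eqxx vu.
    - by exists w; rewrite rw wu inE ws orbT.
    rewrite inE => /and3P[rw /orP[/eqP wk|ws] wu]; last first.
      by right; apply/existsP; exists w; rewrite rw ws wu.
    (* Siblings with the same label coincide by validity. *)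
    left; suff -> : v = w by [].
    apply/eqP/negPn/negP => vw; have [_ _ /(_ r v w rv rw vw)] := T_valid.
    by rewrite vk wk.
  move=> x y; rewrite /= /branches => xr yr x0 y0.
  rewrite (negbTE x0) (negbTE y0) in xr yr.
  have /existsP[w /and3P[rw ws wy]] := yr.
  apply: (adj_distinct_branches T_tree rv rw) => //.
  (* As [s] does not contain [k], the child [w] differs from [v]. *)
  apply/eqP => vw; rewrite -vw vk in ws.
  by case/mapP: ws => k' k's [kk']; rewrite kk' k's in ks.
move=> no; exists (graft (root_tree 'I_n) S2).
  by rewrite big_cons; exists (root_tree 'I_n), S2; split=> //; left.
apply: eq_embeds (embeds_graft adjC _ (embeds_root_tree (adjxx r)) eS2).
  move=> u; rewrite /branches /= orbA orbb; congr (_ || _).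
  apply: eq_existsb => w; rewrite inE.
  by have := no w; case: is_child => //= ->.
by move=> x y /eqP -> _; rewrite eqxx.
Qed.

(** Every child carries a label, and the enumeration lists all labels. *)
Lemma branches_full r : branches r (index_enum 'I_n) =1 branch r.
Proof.
move=> u; rewrite /branches; have [->|ur] /= := eqVneq u r.
  by rewrite branchxx.
apply/existsP/idP => [[v /and3P[rv _ vu]]|ru].
  exact: (branch_child T_tree rv vu).
have [v rv vu] := branch_split T_tree ru ur; exists v; rewrite rv vu andbT.
have := rv; rewrite (is_childE T_tree) => /andP[v0 _].
have [_ /(_ v v0) + _] := T_valid; case: (label T v) => // k _.
by rewrite map_f // mem_index_enum.
Qed.

(** The height bound is relative to [depth r], so it drops by one on passing to a child. *)
Lemma embeds_branch h r : (forall u, branch r u -> depth u <= depth r + h) ->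
  exists2 S, G n h S & embeds S (branch r) r.
Proof.
elim: h r => [|h IH] r rh.
  exists (root_tree 'I_n) => //.
  apply: eq_embeds (embeds_root_tree (adjxx r)) => u /=.
  apply/eqP/idP => [->|ru]; first exact: branchxx.
  by apply: (branch_depth ru); rewrite -[depth r]addn0 rh.
have [|S GS eS] := @embeds_branches (fun=> G n h) r (index_enum 'I_n)
  (index_enum_uniq _).
  move=> v k rv _; apply: IH => u vu.
  by rewrite (is_child_depth rv) addSnnS rh // (branch_child T_tree rv vu).
by exists S => //; apply: eq_embeds eS; apply: branches_full.
Qed.

End Decomposition.

Theorem theorem1 (n h : nat) (n_ge1 : 1 <= n) (T : lgraph 'I_n)
    (T_tree : is_tree T) (T_valid : valid_labeling T)
    (T_height : height T <= h) :
  contains (G n h) T.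
Proof.
(* The branch at the root is the whole tree. *)
have [u _|S GS eS] := @embeds_branch n T T_tree T_valid h (troot T).
  rewrite distxx add0n; apply: leq_trans T_height.
  exact: (leq_bigmax (F := fun v => dist (troot T) v)).
exists S => //; apply: embeds_iso; first by case: T_valid.
by apply: eq_embeds eS => u; rewrite (branch_root T_tree).
Qed.
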